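(* Let a pH descriptor system $$\begin{bmatrix}\tfrac{\mathrm d}{\mathrm dt}Ez(t)\\ y(t)\end{bmatrix}=\begin{bmatrix}J-R&B-P\\ (B+P)^*&S+N\end{bmatrix}\begin{bmatrix}Qz(t)\\ u(t)\end{bmatrix}\qquad(\ast)$$ with $\mathbb{K}^n$-valued state and $\mathbb{K}^m$-valued input and output be given with $$\ker E\cap\ker Q=\{0\}.$$ Let $W:=\begin{bmatrix}R&P\\ P^*&S\end{bmatrix}$, $\Gamma:=\begin{bmatrix}J&B\\ -B^*&-N\end{bmatrix}$, set $r=n+m$, and define $$\mathcal{L}:=\operatorname{ran}\begin{bmatrix}E\\ Q\end{bmatrix}\subset\mathbb{K}^n\times\mathbb{K}^n,\qquad \mathcal{R}:=\operatorname{ran}\begin{bmatrix}I_r\\ -W\end{bmatrix}=\{(f,-Wf):f\in\mathbb{K}^r\}\subset\mathbb{K}^r\times\mathbb{K}^r.$$ Further, with the matrices $$U:=\begin{bmatrix}I_n&0&0\\ 0&0&I_r\\ 0&I_m&0\end{bmatrix}\in\mathbb{K}^{(n+r+m)\times(n+r+m)},\qquad \widetilde D:=\begin{bmatrix}-\Gamma&-I_r\\ I_r&0\end{bmatrix}\in\mathbb{K}^{(n+r+m)\times(n+r+m)},$$ define the subspace $$\mathcal{D}:=\{(U\widetilde DU^*e,\,e):e\in\mathbb{K}^{n+r+m}\}.$$ Then $(\mathcal{D},\mathcal{L},\mathcal{R})$ is a geometric pH system. Moreover, the following hold: (i) If $(u,z,y)$ is a solution of $(\ast)$, then $(u,Ez,y)$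 is a solution of the geometric pH system $(\mathcal{D},\mathcal{L},\mathcal{R})$. (ii) If $(u,x,y)$ is a solution of the geometric pH system $(\mathcal{D},\mathcal{L},\mathcal{R})$ with associated functions $f_R,e_R,e_L$ as in the definition of solution, then $(u,z,y)$ is a solution of $(\ast)$, where $z$ is the unique function satisfying $x=Ez$ and $e_L=Qz$.
   Context: $\mathbb{K}$ denotes either $\mathbb{R}$ or $\mathbb{C}$, consistently throughout. $A^*$ is the conjugate transpose of a matrix $A$, $\langle x,y\rangle=y^*x$ is the Euclidean inner product on $\mathbb{K}^n$, and $\ge 0$ for Hermitian matrices means positive semidefinite. For a linear subspace $\mathcal{A}\subset\mathbb{K}^n\times\mathbb{K}^n$ define the adjoint $\mathcal{A}^*=\{(e',f'):\langle f',e\rangle=\langle e',f\rangle\ \forall (e,f)\in\mathcal{A}\}$ and $-\mathcal{A}=\{(e,-f):(e,f)\in\mathcal{A}\}$. A subspace $\mathcal{L}$ of $\mathbb{K}^n\times\mathbb{K}^n$ is a Lagrange structure if $\mathcal{L}=\mathcal{L}^*$. A subspace $\mathcal{D}$ is a Dirac structure if $\mathcal{D}=-\mathcal{D}^*$. A subspace $\mathcal{R}$ of $\mathbb{K}^n\times\mathbb{K}^n$ is a maximal resistive structure if $\mathcal{R}\subset\mathcal{R}^*$, $\langle e,f\rangle\le 0$ for all $(e,f)\in\mathcal{R}$, and $\dim\mathcal{R}=n$. A geometric pH (port-Hamiltonian) system with state space $\mathbb{K}^n$ and external dimension $m$ is a triple $(\mathcal{D},\mathcal{L},\mathcal{R})$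 consisting of a Dirac structure $\mathcal{D}\subseteq\mathbb{K}^{n+r+m}\times\mathbb{K}^{n+r+m}$, a Lagrange structure $\mathcal{L}\subset\mathbb{K}^n\times\mathbb{K}^n$ and a maximal resistive structure $\mathcal{R}\subset\mathbb{K}^r\times\mathbb{K}^r$. A solution of $(\mathcal{D},\mathcal{L},\mathcal{R})$ is a triple $(u,x,y)\in C([0,\infty);\mathbb{K}^m)\times C^1([0,\infty);\mathbb{K}^n)\times C([0,\infty);\mathbb{K}^m)$ for which there exist continuous functions $f_R,e_R:[0,\infty)\to\mathbb{K}^r$ and $e_L:[0,\infty)\to\mathbb{K}^n$ such that for all $t\ge0$ $$(-\dot x(t),f_R(t),y(t),e_L(t),e_R(t),u(t))\in\mathcal{D},\quad (x(t),e_L(t))\in\mathcal{L},\quad (f_R(t),e_R(t))\in\mathcal{R},$$ where the first three entries form the first component in $\mathbb{K}^{n+r+m}$ and the last three form the second component. A pH descriptor system is a system of the form $(\ast)$ with $\mathbb{K}^m$-valued input $u$ and output $y$, $\mathbb{K}^n$-valued state $z$, and matrices $E,J,R,Q\in\mathbb{K}^{n\times n}$, $B,P\in\mathbb{K}^{n\times m}$, $S,N\in\mathbb{K}^{m\times m}$ satisfying $E^*Q=Q^*E$, $J=-J^*$, $N=-N^*$, $R=R^*$, $S=S^*$ and $$\begin{bmatrix}Q^*&0\\ 0&I\end{bmatrix}\begin{bmatrix}R&P\\ P^*&S\end{bmatrix}\begin{bmatrix}Q&0\\ 0&I\end{bmatrix}\ge0.$$ A solution of $(\ast)$ is a triple $(u,z,y)\in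 C([0,\infty);\mathbb{K}^{n+2m})$ with $Ez\in C^1([0,\infty);\mathbb{K}^n)$ such that $(\ast)$ is satisfied for all $t\ge 0$.
   Formalization: The claim that (D,L,R) is a geometric pH system is proved under the added condition W ≥ 0, since the weighted positivity does not imply it for singular Q (E=1, Q=0, R=-1, rest 0 is a counterexample); D Dirac, L Lagrange, (i) and (ii) hold without it. *)

(* Defs.v *)
(* MathComp + MathComp-Analysis *)
From HB Require Import structures.
From mathcomp Require Import all_boot all_order all_algebra.
From mathcomp Require Import complex.
From mathcomp Require Import all_classical all_reals all_analysis.

Set Implicit Arguments.
Unset Strict Implicit.
Unset Printing Implicit Defensive.

Import Order.TTheory GRing.Theory Num.Theory.
Import numFieldNormedType.Exports.

Local Open Scope classical_set_scope.
Local Open Scope ring_scope.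

(* The field K is one of the reals or the complex numbers over them.  The order
   on R[i] is the partial order with 0 <= z iff z is real and nonnegative, so
   that an inequality between scalars also asserts that they differ by a real. *)
Variant scalar_kind := RealScalars | ComplexScalars.

Definition scalar_field (R : realType) (k : scalar_kind) : numFieldType :=
  match k with
  | RealScalars => R
  | ComplexScalars => R[i]%C
  end.

Definition conj_scalar (R : realType) (k : scalar_kind) :
    scalar_field R k -> scalar_field R k :=
  match k with
  | RealScalars => fun a => a
  | ComplexScalars => fun a => conjc a
  end.

Definition of_real (R : realType) (k : scalar_kind) : R -> scalar_field R k :=
  match k with
  | RealScalars => fun a => a
  | ComplexScalars => fun a => real_complex R a
  end.

Section LinearRelations.
Context {R : realType} {k : scalar_kind}.
Local Notation K := (scalar_field R k).

Definition adjmx {p q : nat} (A : 'M[K]_(p, q)) : 'M[K]_(q, p) :=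
  (map_mx (@conj_scalar R k) A)^T.

(* <x, y> = y^* x, linear in the first argument. *)
Definition inner {p : nat} (x y : 'cV[K]_p) : K := (adjmx y *m x) 0 0.

Definition psdmx {p : nat} (A : 'M[K]_p) : Prop :=
  adjmx A = A /\ forall x : 'cV[K]_p, 0 <= inner (A *m x) x.

Definition adjoint_rel {p : nat} (A : set ('cV[K]_p * 'cV[K]_p)) :
    set ('cV[K]_p * 'cV[K]_p) :=
  [set a | forall b, A b -> inner a.2 b.1 = inner a.1 b.2].

Definition opp_rel {p : nat} (A : set ('cV[K]_p * 'cV[K]_p)) :
    set ('cV[K]_p * 'cV[K]_p) :=
  [set (a.1, - a.2) | a in A].

Definition lagrange_structure {p : nat}
    (L : {vspace 'cV[K]_p * 'cV[K]_p}) : Prop :=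
  [set` L] = adjoint_rel [set` L].

Definition dirac_structure {p : nat}
    (D : {vspace 'cV[K]_p * 'cV[K]_p}) : Prop :=
  [set` D] = opp_rel (adjoint_rel [set` D]).

Definition maximal_resistive_structure {p : nat}
    (Rs : {vspace 'cV[K]_p * 'cV[K]_p}) : Prop :=
  [/\ [set` Rs] `<=` adjoint_rel [set` Rs],
      forall a, a \in Rs -> inner a.1 a.2 <= 0
    & \dim Rs = p].

Definition pair_mulmx {p q : nat} (A B : 'M[K]_(p, q)) (x : 'cV[K]_q) :
    'cV[K]_p * 'cV[K]_p :=
  (A *m x, B *m x).

Fact pair_mulmx_is_linear {p q : nat} (A B : 'M[K]_(p, q)) :
  linear (pair_mulmx A B).
Proof. by move=> a x y; rewrite /pair_mulmx !linearP. Qed.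

HB.instance Definition _ (p q : nat) (A B : 'M[K]_(p, q)) :=
  GRing.isLinear.Build K 'cV[K]_q ('cV[K]_p * 'cV[K]_p)%type *:%R
    (pair_mulmx A B) (@pair_mulmx_is_linear p q A B).

Definition ran_pair {p q : nat} (A B : 'M[K]_(p, q)) :
    {vspace 'cV[K]_p * 'cV[K]_p} :=
  limg (linfun (pair_mulmx A B)).

Lemma ran_pairP {p q : nat} (A B : 'M[K]_(p, q)) :
  [set` ran_pair A B] = [set (A *m x, B *m x) | x in setT].
Proof.
apply/seteqP; split=> [a /memv_imgP[x _ ->]|a [x _ <-]].
  by exists x => //; rewrite lfunE.
by apply/memv_imgP; exists x; rewrite ?memvf // lfunE.
Qed.

End LinearRelations.

Section TimeFunctions.
Context {R : realType} {k : scalar_kind}.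
Local Notation K := (scalar_field R k).

(* A function on [0, oo) is represented by a total function on R, of which only
   the values at t >= 0 are used. *)
Definition continuous_ge0 {p : nat} (f : R -> 'cV[K]_p) : Prop :=
  {within [set t | 0 <= t], continuous f}.

(* The increment h is restricted so that t + h >= 0: the derivative at 0 is the
   right derivative. *)
Definition is_derive_ge0 {p : nat} (f df : R -> 'cV[K]_p) : Prop :=
  forall t : R, 0 <= t ->
    (of_real k h)^-1 *: (f (t + h) - f t)
      @[h --> within [set h | 0 <= t + h] (0 : R)^'] --> df t.

Definition is_C1_ge0 {p : nat} (f df : R -> 'cV[K]_p) : Prop :=
  is_derive_ge0 f df /\ continuous_ge0 df.

End TimeFunctions.

Section PortHamiltonian.
Context {R : realType} {k : scalar_kind}.
Local Notation K := (scalar_field R k).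

Definition geometric_pH {n r m : nat}
    (D : {vspace 'cV[K]_(n + r + m) * 'cV[K]_(n + r + m)})
    (L : {vspace 'cV[K]_n * 'cV[K]_n})
    (Rs : {vspace 'cV[K]_r * 'cV[K]_r}) : Prop :=
  [/\ dirac_structure D, lagrange_structure L
    & maximal_resistive_structure Rs].

Definition geometric_solution_with {n r m : nat}
    (D : {vspace 'cV[K]_(n + r + m) * 'cV[K]_(n + r + m)})
    (L : {vspace 'cV[K]_n * 'cV[K]_n})
    (Rs : {vspace 'cV[K]_r * 'cV[K]_r})
    (u : R -> 'cV[K]_m) (x : R -> 'cV[K]_n) (y : R -> 'cV[K]_m)
    (fR eR : R -> 'cV[K]_r) (eL : R -> 'cV[K]_n) : Prop :=
  [/\ continuous_ge0 u, continuous_ge0 y,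
      [/\ continuous_ge0 fR, continuous_ge0 eR & continuous_ge0 eL]
    & exists2 dx : R -> 'cV[K]_n, is_C1_ge0 x dx &
        forall t : R, 0 <= t ->
          [/\ (col_mx (col_mx (- dx t) (fR t)) (y t),
               col_mx (col_mx (eL t) (eR t)) (u t)) \in D,
              (x t, eL t) \in L
            & (fR t, eR t) \in Rs]].

Definition geometric_solution {n r m : nat}
    (D : {vspace 'cV[K]_(n + r + m) * 'cV[K]_(n + r + m)})
    (L : {vspace 'cV[K]_n * 'cV[K]_n})
    (Rs : {vspace 'cV[K]_r * 'cV[K]_r})
    (u : R -> 'cV[K]_m) (x : R -> 'cV[K]_n) (y : R -> 'cV[K]_m) : Prop :=
  exists (fR eR : R -> 'cV[K]_r) (eL : R -> 'cV[K]_n),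
    geometric_solution_with D L Rs u x y fR eR eL.

(* The weighted condition gives only the sign of W on ran Q x K^m, not W >= 0,
   when Q is singular. *)
Definition pH_descriptor {n m : nat} (E J Rd Q : 'M[K]_n)
    (B P : 'M[K]_(n, m)) (S N : 'M[K]_m) : Prop :=
  [/\ adjmx E *m Q = adjmx Q *m E,
      J = - adjmx J /\ N = - adjmx N,
      Rd = adjmx Rd /\ S = adjmx S
    & psdmx (block_mx (adjmx Q) 0 0 1%:M *m block_mx Rd P (adjmx P) S
               *m block_mx Q 0 0 1%:M)].

Definition descriptor_solution {n m : nat} (E J Rd Q : 'M[K]_n)
    (B P : 'M[K]_(n, m)) (S N : 'M[K]_m)
    (u : R -> 'cV[K]_m) (z : R -> 'cV[K]_n) (y : R -> 'cV[K]_m) : Prop :=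
  [/\ continuous_ge0 u, continuous_ge0 z, continuous_ge0 y
    & exists2 dEz : R -> 'cV[K]_n, is_C1_ge0 (fun t => E *m z t) dEz &
        forall t : R, 0 <= t ->
          col_mx (dEz t) (y t) =
            block_mx (J - Rd) (B - P) (adjmx (B + P)) (S + N)
              *m col_mx (Q *m z t) (u t)].

End PortHamiltonian.

(* Main.v *)
(* The adjoint of [ran (A, B)] consists of the (a, b) such that [A^* b = B^* a].
   Hence the graph of a skew-adjoint matrix is Dirac, and [D] is such a graph, of
   the matrix [U Dt U^*].  For [L], the condition [E^* Q = Q^* E] puts the column
   space of the stacked matrix of [E] over [Q] inside the kernel of the row block
   matrix of [Q^*] and [- E^*]; since [ker E] and [ker Q] meet trivially, both
   spaces have dimension n, so they coincide.  Eliminating [f_R = (e_L, u)] and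
   [e_R = - W f_R] from the inclusions in [D] and [Rs] leaves exactly the
   descriptor equations, and a left inverse of [E] stacked over [Q] recovers z
   continuously from [(x, e_L)]. *)
Require Import Defs.
From HB Require Import structures.
From mathcomp Require Import all_boot all_order all_algebra.
From mathcomp Require Import complex.
From mathcomp Require Import all_classical all_reals all_analysis.

Set Implicit Arguments.
Unset Strict Implicit.
Unset Printing Implicit Defensive.

Import Order.TTheory GRing.Theory Num.Theory.
Import numFieldNormedType.Exports.

Local Open Scope classical_set_scope.
Local Open Scope ring_scope.

(** * Conjugation and real scalars, treated uniformly in the choice of field *)

Section Scalars.
Context {R : realType} {k : scalar_kind}.
Local Notation K := (scalar_field R k).
Local Notation conj := (@conj_scalar R k).

Fact conj_scalar_is_additive : {morph conj : x y / x - y}.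
Proof. by rewrite /conj_scalar; case: k => // x y; rewrite rmorphB. Qed.

Fact conj_scalar_is_multiplicative : monoid_morphism conj.
Proof.
rewrite /conj_scalar; case: k; split=> //.
  exact: (rmorph1 (@conjc R)).
exact: (rmorphM (@conjc R)).
Qed.

HB.instance Definition _ :=
  GRing.isZmodMorphism.Build K K conj conj_scalar_is_additive.
HB.instance Definition _ :=
  GRing.isMonoidMorphism.Build K K conj conj_scalar_is_multiplicative.

Lemma conj_scalarK : involutive conj.
Proof. by rewrite /conj_scalar; case: k => // x; exact: conjcK. Qed.

Lemma of_real_neq0 (h : R) : h != 0 -> of_real k h != 0.
Proof.
rewrite /of_real; case: k => // h0.
by apply: contra h0 => /eqP[->].
Qed.

Lemma cvg_of_real0 : of_real k h @[h --> (0 : R)] --> (0 : K).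
Proof.
apply/cvgr0Pnorm_lt => e.
rewrite /of_real; case: k e => e e0.
  by exists e => // h; rewrite /= sub0r normrN.
(* A positive complex [e] has zero imaginary part, so its real part serves as the radius. *)
case: e e0 => a b; rewrite ltcE /= => /andP[/eqP -> a0].
exists a => // h; rewrite /= sub0r normrN => ha.
by rewrite normc_def /= expr0n addr0 sqrtr_sqr ltcE /= eqxx.
Qed.

End Scalars.

(** * Adjoint matrices and linear relations given as ranges *)

Section Relations.
Context {R : realType} {k : scalar_kind}.
Local Notation K := (scalar_field R k).

Lemma adjmxK {p q : nat} (A : 'M[K]_(p, q)) : adjmx (adjmx A) = A.
Proof. by apply/matrixP=> i j; rewrite !mxE conj_scalarK. Qed.

Lemma adjmxM {p q r : nat} (A : 'M[K]_(p, q)) (B : 'M[K]_(q, r)) :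
  adjmx (A *m B) = adjmx B *m adjmx A.
Proof. by rewrite /adjmx map_mxM trmx_mul. Qed.

Lemma adjmxD {p q : nat} (A B : 'M[K]_(p, q)) :
  adjmx (A + B) = adjmx A + adjmx B.
Proof. by rewrite /adjmx map_mxD linearD. Qed.

Lemma adjmxN {p q : nat} (A : 'M[K]_(p, q)) : adjmx (- A) = - adjmx A.
Proof. by rewrite /adjmx map_mxN linearN. Qed.

Lemma adjmx0 {p q : nat} : adjmx (0 : 'M[K]_(p, q)) = 0.
Proof. by rewrite /adjmx map_mx0 trmx0. Qed.

Lemma adjmx1 {p : nat} : adjmx (1%:M : 'M[K]_p) = 1%:M.
Proof. by rewrite /adjmx map_mx1 trmx1. Qed.

Lemma adj_row_mx {p q r : nat} (A : 'M[K]_(p, q)) (B : 'M[K]_(p, r)) :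
  adjmx (row_mx A B) = col_mx (adjmx A) (adjmx B).
Proof. by rewrite /adjmx map_row_mx tr_row_mx. Qed.

Lemma adj_col_mx {p q r : nat} (A : 'M[K]_(p, q)) (B : 'M[K]_(r, q)) :
  adjmx (col_mx A B) = row_mx (adjmx A) (adjmx B).
Proof. by rewrite /adjmx map_col_mx tr_col_mx. Qed.

Lemma adj_block_mx {p q r s : nat} (A : 'M[K]_(p, q)) (B : 'M[K]_(p, r))
    (C : 'M[K]_(s, q)) (D : 'M[K]_(s, r)) :
  adjmx (block_mx A B C D) =
    block_mx (adjmx A) (adjmx C) (adjmx B) (adjmx D).
Proof. by rewrite /adjmx map_block_mx tr_block_mx. Qed.

Lemma adjmx_delta {p q : nat} (i : 'I_p) (j : 'I_q) :
  adjmx (delta_mx i j : 'M[K]_(p, q)) = delta_mx j i.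
Proof. by rewrite /adjmx map_delta_mx trmx_delta. Qed.

Lemma inner_mulmxr {p q : nat} (A : 'M[K]_(p, q)) x y :
  inner x (A *m y) = inner (adjmx A *m x) y.
Proof. by rewrite /inner adjmxM mulmxA. Qed.

Lemma inner_ext {p : nat} (x y : 'cV[K]_p) :
  (forall v, inner x v = inner y v) -> x = y.
Proof.
move=> xy; apply/colP => i; have := xy (delta_mx i 0).
by rewrite /inner adjmx_delta -!rowE !mxE.
Qed.

Lemma mem_ran_pair {p q : nat} (A B : 'M[K]_(p, q)) a :
  (a \in ran_pair A B) <-> exists x, a = (A *m x, B *m x).
Proof.
split=> [|[x ->]].
  move=> /memv_imgP[x _ ->]; exists x.
  by rewrite lfunE.
by apply/memv_imgP; exists x; rewrite ?memvf // lfunE.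
Qed.

(** Moving [A] and [B] across the inner product leaves an identity tested against every [x], which
    [inner_ext] turns into one equation. *)
Lemma adjoint_ran_pair {p q : nat} (A B : 'M[K]_(p, q)) :
  adjoint_rel [set` ran_pair A B] =
    [set a | adjmx A *m a.2 = adjmx B *m a.1].
Proof.
apply/seteqP; split=> a /= ab.
  apply: inner_ext => x; rewrite -!inner_mulmxr.
  by apply: (ab (A *m x, B *m x)); apply/mem_ran_pair; exists x.
by move=> _ /mem_ran_pair[x ->] /=; rewrite !inner_mulmxr ab.
Qed.

Lemma dirac_ran_pair {p : nat} (A : 'M[K]_p) :
  adjmx A = - A -> dirac_structure (ran_pair A 1%:M).
Proof.
move=> AN; rewrite /dirac_structure adjoint_ran_pair adjmx1 AN.
apply/seteqP; split=> [_ /mem_ran_pair[x ->]|_ [[a b] /= ab <-]].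
  exists (A *m x, - x) => /=; rewrite ?opprK ?mul1mx //.
  by rewrite mulmxN mulNmx opprK.
apply/mem_ran_pair; exists (- b).
by rewrite !mul1mx mulNmx -mulmxN in ab *; rewrite -ab.
Qed.

Lemma lagrange_ran_pair {p : nat} (E Q : 'M[K]_p) :
  adjmx E *m Q = adjmx Q *m E ->
  (forall v : 'cV[K]_p, E *m v = 0 -> Q *m v = 0 -> v = 0) ->
  lagrange_structure (ran_pair E Q).
Proof.
move=> EQ kerEQ; rewrite /lagrange_structure adjoint_ran_pair.
apply/seteqP; split=> [_ /mem_ran_pair[x ->] /=|[a b] /= ab].
  by rewrite !mulmxA EQ.
(* Ranks and kernels act on rows, so the stacked matrix of [E] over [Q] enters transposed, as [M];
   the pairs in the adjoint are, transposed, the rows killed by [C^T]. *)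
pose M := row_mx E^T Q^T; pose C := row_mx (adjmx Q) (- adjmx E).
have rkM : \rank M = p.
  apply/eqP/inj_row_free => v; rewrite mul_mx_row -row_mx0.
  move=> /eq_row_mx[vE vQ]; apply/trmx_inj; rewrite trmx0.
  by apply: kerEQ; apply/trmx_inj; rewrite trmx_mul trmxK trmx0.
have rkC : \rank C = p.
  apply/eqP/inj_row_free => v; rewrite mul_mx_row -row_mx0.
  move=> /eq_row_mx[vQ /eqP]; rewrite mulmxN oppr_eq0 => /eqP vE.
  rewrite -[v]adjmxK -[RHS]adjmx0; congr adjmx; apply: kerEQ.
    by rewrite -[E]adjmxK -adjmxM vE adjmx0.
  by rewrite -[Q]adjmxK -adjmxM vQ adjmx0.
have MC : M *m C^T = 0.
  apply/trmx_inj; rewrite trmx_mul trmxK trmx0 tr_row_mx !trmxK mul_row_col.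
  by rewrite mulNmx EQ subrr.
(* [MC] gives one inclusion, and the kernel has rank [p + p - p], the rank of [M]. *)
have /andP[_ kerM] : (M == kermx C^T)%MS.
  rewrite -(geq_leqif (mxrank_leqif_eq _)); last exact/sub_kermxP.
  by rewrite mxrank_ker mxrank_tr rkM rkC addnK.
have /sub_kermxP/submx_trans/(_ kerM)/submxP[x xM] :
    row_mx a^T b^T *m C^T = 0.
  apply/trmx_inj; rewrite trmx_mul trmxK trmx0 tr_row_mx !trmxK mul_row_col.
  by rewrite mulNmx ab subrr.
apply/mem_ran_pair; exists x^T; move: xM.
rewrite mul_mx_row => /eq_row_mx[aE bQ].
by congr pair; apply/trmx_inj; rewrite trmx_mul trmxK.
Qed.

Lemma resistive_ran_pair {p : nat} (W : 'M[K]_p) :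
  psdmx W -> maximal_resistive_structure (ran_pair 1%:M (- W)).
Proof.
move=> [WW W0]; split.
- rewrite adjoint_ran_pair => _ /mem_ran_pair[x ->] /=.
  by rewrite adjmx1 adjmxN WW !mul1mx.
- move=> _ /mem_ran_pair[x ->] /=; rewrite mul1mx inner_mulmxr adjmxN WW mulNmx.
  have := W0 x.
  by rewrite /inner mulmxN !mxE oppr_le0.
(* The first component of the parametrization is the identity, so its kernel is trivial and the
   dimension [p] is preserved. *)
- rewrite limg_dim_eq ?dimvf /dim /= ?muln1 //.
  apply/eqP; rewrite -subv0; apply/subvP => x.
  rewrite memv_cap memvf memv_ker memv0 lfunE /= /pair_mulmx mul1mx.
  by move=> /eqP[->].
Qed.

End Relations.

(** * Continuity and differentiation on the half-line *)

Section Time.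
Context {R : realType} {k : scalar_kind}.
Local Notation K := (scalar_field R k).

Lemma cvg_mx {T : Type} {F : set_system T} {FF : Filter F} {p q : nat}
    (f : T -> 'M[K]_(p, q)) (M : 'M[K]_(p, q)) :
  (forall i j, f x i j @[x --> F] --> M i j) -> f @ F --> M.
Proof.
move=> fM A [P MP PA]; apply: (filterS (fun x => PA (f x))).
by apply: filter_forall => i; apply: filter_forall => j; exact: fM.
Qed.

Lemma mulmx_continuous {p q r : nat} (A : 'M[K]_(p, q)) :
  continuous (fun x : 'M[K]_(q, r) => A *m x).
Proof.
move=> x; apply: (@cvg_mx _ (nbhs x)) => i j; rewrite mxE.
under eq_cvg do rewrite mxE.
apply: cvg_big => [|l _]; first exact: add_continuous.
by apply: cvgMl_tmp; exact: coord_continuous.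
Qed.

Lemma continuous_ge0_comp {p q : nat} (g : 'cV[K]_p -> 'cV[K]_q) f :
  continuous g -> continuous_ge0 f -> continuous_ge0 (fun t => g (f t)).
Proof.
by move=> gc fc t; apply: continuous_comp; [exact: fc | exact: gc].
Qed.

Lemma continuous_ge0_col_mx {p q : nat} (f : R -> 'cV[K]_p) (g : R -> 'cV[K]_q) :
  continuous_ge0 f -> continuous_ge0 g ->
  continuous_ge0 (fun t => col_mx (f t) (g t)).
Proof.
move=> fc gc.
(* Stacking is a sum of two products with constant matrices, so [mulmx_continuous] applies. *)
have -> : (fun t => col_mx (f t) (g t)) =
    (fun t => col_mx 1%:M 0 *m f t) \+ (fun t => col_mx 0 1%:M *m g t).
  apply/funext => t /=; rewrite !mul_col_mx !mul1mx !mul0mx add_col_mx.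
  by rewrite addr0 add0r.
move=> t; apply: cvgD.
  exact: (continuous_ge0_comp (mulmx_continuous (A := col_mx 1%:M 0)) fc).
exact: (continuous_ge0_comp (mulmx_continuous (A := col_mx 0 1%:M)) gc).
Qed.

Lemma eq_is_derive_ge0 {p : nat} (f g df : R -> 'cV[K]_p) :
  (forall t, 0 <= t -> f t = g t) -> is_derive_ge0 f df -> is_derive_ge0 g df.
Proof.
move=> fg fdf t t0; apply: cvg_trans (fdf t t0).
apply: fmap_within_eq => h /set_mem /= th0.
by rewrite !fg.
Qed.

(** The increment of [f] is [h] times a convergent quotient, hence tends to zero. *)
Lemma derive_continuous_ge0 {p : nat} (f df : R -> 'cV[K]_p) :
  is_derive_ge0 f df -> continuous_ge0 f.
Proof.
move=> fdf; apply/subspace_continuousP => t /= t0.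
have fc : of_real k h *: ((of_real k h)^-1 *: (f (t + h) - f t)) + f t
    @[h --> within [set h | 0 <= t + h] (0 : R)^'] --> 0 *: df t + f t.
  apply: cvgD; last exact: cvg_cst.
  apply: cvgZ; last exact: fdf.
  apply: cvg_within_filter; apply: cvg_within_filter; exact: cvg_of_real0.
rewrite scale0r add0r in fc.
move=> V Vft.
have fV : \forall h \near (0 : R), h != 0 -> 0 <= t + h ->
    V (of_real k h *: ((of_real k h)^-1 *: (f (t + h) - f t)) + f t).
  exact: fc Vft.
change (\forall x \near t, 0 <= x -> V (f x)).
apply/nbhs0P; apply: filterS fV => h hV th0.
(* The punctured limit says nothing at [h = 0]; there [V] contains [f t] as its neighbourhood. *)
have [->|h0] := eqVneq h 0; first by rewrite addr0; exact: nbhs_singleton.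
have := hV h0 th0; rewrite /= scalerA divff ?of_real_neq0 // scale1r subrK.
exact.
Qed.

End Time.

(** * The port permutation and membership in the Dirac structure *)

Section Ports.
Context {R : realType} {k : scalar_kind} {n m : nat}.
Local Notation K := (scalar_field R k).

(** The matrix [U] of the theorem: it moves the resistive block from the last place to the middle
    one, and its adjoint moves it back. *)
Definition port_perm : 'M[K]_(n + (n + m) + m, n + m + (n + m)) :=
  block_mx (block_mx 1%:M 0 0 0) (col_mx 0 1%:M) (row_mx 0 1%:M) 0.

Definition port_skew (G : 'M[K]_(n + m)) : 'M[K]_(n + m + (n + m)) :=
  block_mx (- G) (- 1%:M) 1%:M 0.

Lemma adj_port_skew (G : 'M[K]_(n + m)) :
  adjmx G = - G -> adjmx (port_skew G) = - port_skew G.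
Proof.
move=> GN; rewrite /port_skew adj_block_mx !adjmxN adjmx0 adjmx1 GN.
by rewrite opp_block_mx !opprK oppr0.
Qed.

Lemma port_perm_mul (a : 'cV[K]_n) (b : 'cV[K]_m) (c : 'cV[K]_(n + m)) :
  port_perm *m col_mx (col_mx a b) c = col_mx (col_mx a c) b.
Proof.
rewrite /port_perm !mul_block_col mul_col_mx mul_row_col.
by rewrite !mul0mx !mul1mx add_col_mx !addr0 !add0r.
Qed.

Lemma adj_port_perm_mul (a : 'cV[K]_n) (b : 'cV[K]_m) (c : 'cV[K]_(n + m)) :
  adjmx port_perm *m col_mx (col_mx a c) b = col_mx (col_mx a b) c.
Proof.
rewrite /port_perm !adj_block_mx adj_col_mx adj_row_mx !adjmx0 !adjmx1.
rewrite !mul_block_col mul_col_mx mul_row_col.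
by rewrite !mul0mx !mul1mx add_col_mx !addr0 !add0r.
Qed.

Lemma mem_port_relation (G : 'M[K]_(n + m))
    (dx eL : 'cV[K]_n) (fR eR : 'cV[K]_(n + m)) (y u : 'cV[K]_m) :
  ((col_mx (col_mx dx fR) y, col_mx (col_mx eL eR) u)
    \in ran_pair (port_perm *m port_skew G *m adjmx port_perm) 1%:M) <->
  col_mx dx y = - (G *m col_mx eL u) - eR /\ fR = col_mx eL u.
Proof.
set A := _ *m adjmx _.
(* After reordering, [port_skew] acts on [(eL, u)] and [eR]: its first row yields [w], whose two
   parts fill the state and output slots, and its second row copies [(eL, u)] into the resistive
   slot. *)
have AE : A *m col_mx (col_mx eL eR) u =
    let w := - (G *m col_mx eL u) - eR in
    col_mx (col_mx (usubmx w) (col_mx eL u)) (dsubmx w).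
  rewrite /A -!mulmxA adj_port_perm_mul /port_skew mul_block_col.
  rewrite !mulNmx !mul1mx mul0mx addr0 -[X in col_mx X _]vsubmxK.
  by rewrite port_perm_mul.
split=> [/mem_ran_pair[x [+ ex]]|[w ->]].
  rewrite mul1mx in ex; rewrite -ex AE /=.
  by move=> /eq_col_mx[/eq_col_mx[-> ->] ->]; rewrite vsubmxK.
apply/mem_ran_pair; exists (col_mx (col_mx eL eR) u).
by rewrite mul1mx AE /= -w col_mxKu col_mxKd.
Qed.

End Ports.

(** * The descriptor system and its geometric counterpart *)

Theorem theorem18 (R : realType) (k : scalar_kind) (n m : nat)
    (E J Rd Q : 'M[scalar_field R k]_n) (B P : 'M[scalar_field R k]_(n, m))
    (S N : 'M[scalar_field R k]_m)
    (pH : pH_descriptor E J Rd Q B P S N)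
    (kerEQ : forall v : 'cV[scalar_field R k]_n, E *m v = 0 -> Q *m v = 0 -> v = 0) :
  let W : 'M[scalar_field R k]_(n + m) := block_mx Rd P (adjmx P) S in
  let Gamma : 'M[scalar_field R k]_(n + m) := block_mx J B (- adjmx B) (- N) in
  let L := ran_pair E Q in
  let Rs := ran_pair 1%:M (- W) in
  let U : 'M[scalar_field R k]_(n + (n + m) + m, n + m + (n + m)) :=
    block_mx (block_mx 1%:M 0 0 0) (col_mx 0 1%:M) (row_mx 0 1%:M) 0 in
  let Dt : 'M[scalar_field R k]_(n + m + (n + m)) :=
    block_mx (- Gamma) (- 1%:M) 1%:M 0 in
  let D := ran_pair (U *m Dt *m adjmx U) 1%:M in
  [/\ dirac_structure D,
      lagrange_structure L,
      psdmx W -> geometric_pH D L Rs,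
      forall (u : R -> 'cV[scalar_field R k]_m) (z : R -> 'cV[scalar_field R k]_n)
          (y : R -> 'cV[scalar_field R k]_m),
        descriptor_solution E J Rd Q B P S N u z y ->
        geometric_solution D L Rs u (fun t => E *m z t) y
    & forall (u : R -> 'cV[scalar_field R k]_m) (x : R -> 'cV[scalar_field R k]_n)
          (y : R -> 'cV[scalar_field R k]_m)
          (fR eR : R -> 'cV[scalar_field R k]_(n + m))
          (eL : R -> 'cV[scalar_field R k]_n),
        geometric_solution_with D L Rs u x y fR eR eL ->
        exists z : R -> 'cV[scalar_field R k]_n,
          [/\ forall t : R, 0 <= t -> x t = E *m z t /\ eL t = Q *m z t,
              forall z' : R -> 'cV[scalar_field R k]_n,
                (forall t : R, 0 <= t -> x t = E *m z' t /\ eL t = Q *m z' t) ->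
                forall t : R, 0 <= t -> z' t = z t
            & descriptor_solution E J Rd Q B P S N u z y]].
Proof.
move=> W Gamma L Rs U Dt D; case: pH => EQ [JN NN] _ _.
have GammaN : adjmx Gamma = - Gamma.
  rewrite /Gamma adj_block_mx !adjmxN adjmxK opp_block_mx !opprK.
  by rewrite {2}JN {2}NN !opprK.
have dirD : dirac_structure D.
  apply: dirac_ran_pair; rewrite !adjmxM adjmxK mulmxA.
  by rewrite [X in _ *m X *m _](adj_port_skew GammaN) mulmxN mulNmx.
have lagL : lagrange_structure L by exact: lagrange_ran_pair.
have DE (dx eL : 'cV_n) (y u : 'cV_m) fR eR : eR = - (W *m fR) ->
    (col_mx (col_mx (- dx) fR) y, col_mx (col_mx eL eR) u) \in D <->
    fR = col_mx eL u /\
    col_mx dx y = block_mx (J - Rd) (B - P) (adjmx (B + P)) (S + N)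
                    *m col_mx eL u.
  move=> ->; rewrite (mem_port_relation Gamma).
  (* [- Gamma + W] is the descriptor matrix with its first block row negated, matching the entry
     [- dx]. *)
  have E1 : - (Gamma *m col_mx eL u) + W *m col_mx eL u =
      col_mx (- ((J - Rd) *m eL + (B - P) *m u))
             (adjmx (B + P) *m eL + (S + N) *m u).
    rewrite !mul_block_col opp_col_mx add_col_mx !mulmxDl !mulNmx adjmxD mulmxDl.
    congr col_mx; rewrite !opprD !opprK.
      by rewrite addrACA.
    by rewrite addrACA; congr (_ + _); rewrite addrC.
  rewrite (mul_block_col (J - Rd)); split=> [[+ fE]|[fE]].
    rewrite fE opprK E1 => /eq_col_mx[/oppr_inj -> ->]; split=> //.
  by move=> /eq_col_mx[-> ->]; rewrite fE opprK E1.
split=> //.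
(* [Rs] is the graph of [- W] over the whole space, so the sign of [W] is asked on all vectors. *)
- by move=> W0; split=> //; exact: resistive_ran_pair.
- move=> u z y [uc zc yc [dEz C1 dyn]].
  have fc : continuous_ge0 (fun t => col_mx (Q *m z t) (u t)).
    apply: continuous_ge0_col_mx uc.
    exact: (continuous_ge0_comp (mulmx_continuous (A := Q)) zc).
  (* [L] suggests [eL = Q z]; then [D] forces [fR = (eL, u)] and [Rs] forces [eR = - W fR]. *)
  exists (fun t => col_mx (Q *m z t) (u t)).
  exists (fun t => - W *m col_mx (Q *m z t) (u t)).
  exists (fun t => Q *m z t).
  split=> //.
    split=> //.
      exact: (continuous_ge0_comp (mulmx_continuous (A := - W)) fc).
    exact: (continuous_ge0_comp (mulmx_continuous (A := Q)) zc).
  exists dEz => // t t0; split.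
  + by apply/DE; [rewrite mulNmx | rewrite dyn].
  + by apply/mem_ran_pair; exists (z t).
  + by apply/mem_ran_pair; exists (col_mx (Q *m z t) (u t)); rewrite mul1mx.
- move=> u x y fR eR eL [uc yc [fRc eRc eLc] [dx [xder dxc] sol]].
  have /row_fullP[V VEQ] : row_full (col_mx E Q).
    rewrite /row_full -mxrank_tr tr_col_mx; apply/inj_row_free => v.
    rewrite mul_mx_row -row_mx0 => /eq_row_mx[vE vQ].
    apply/trmx_inj; rewrite trmx0.
    by apply: kerEQ; apply/trmx_inj; rewrite trmx_mul trmxK trmx0.
  pose z t := V *m col_mx (x t) (eL t).
  (* This serves twice: it identifies [z t] with the preimage that membership in [L] provides, and
     it gives uniqueness. *)
  have zE t z0 : x t = E *m z0 -> eL t = Q *m z0 -> z0 = z t.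
    by rewrite /z => -> ->; rewrite -mul_col_mx mulmxA VEQ mul1mx.
  have xzE t : 0 <= t -> x t = E *m z t /\ eL t = Q *m z t.
    move=> /sol[_ /mem_ran_pair[z0 [xE eE]] _].
    by rewrite -(zE t z0).
  exists z; split=> //.
    by move=> z' z'E t /z'E[xE eE]; exact: zE.
  split=> //.
    apply: (continuous_ge0_comp (mulmx_continuous (A := V))).
    exact: continuous_ge0_col_mx (derive_continuous_ge0 xder) eLc.
  exists dx.
    (* [x] and [E z] are known to agree only for [0 <= t], which suffices for the one-sided
       derivative. *)
    by split=> //; apply: eq_is_derive_ge0 xder => t /xzE[].
  move=> t t0; have [Dt' _ /mem_ran_pair[f [fRE eRE]]] := sol t t0.
  have [_ <-] := xzE t t0.
  have := Dt'; rewrite DE; first by case.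
  by rewrite eRE fRE mul1mx mulNmx.
Qed.
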